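(* Fix an integer $k\ge 3$. For every rational number $\alpha\in[0,1)$, there exists a finite family $\mathcal{F}$ of $k$-graphs such that $\gamma(\mathcal{F})=\alpha$.
   Context: A $k$-graph ($k$-uniform hypergraph) $H$ consists of a vertex set $V(H)$ and an edge set $E(H)\subseteq\binom{V(H)}{k}$. For a $(k-1)$-subset $S\subseteq V(H)$, $d_H(S)$ is the number of edges of $H$ containing $S$. The minimum codegree $\delta_{k-1}(H)$ is the minimum of $d_H(S)$ over all $(k-1)$-subsets $S$ of $V(H)$. For a family $\mathcal{F}$ of $k$-graphs, a $k$-graph is $\mathcal{F}$-free if it contains no member of $\mathcal{F}$ as a (not necessarily induced) subgraph. The codegree Turán number $\mathrm{co\text{-}ex}(n,\mathcal{F})$ is the maximum of $\delta_{k-1}(H)$ over all $n$-vertex $\mathcal{F}$-free $k$-graphs $H$, and the codegree Turán density is $\gamma(\mathcal{F})=\lim_{n\to\infty}\mathrm{co\text{-}ex}(n,\mathcal{F})/n$ (this limit is known to exist for every family $\mathcal{F}$). *)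

(* Defs.v *)
From HB Require Import structures.
From mathcomp Require Import all_boot all_order all_algebra.
From mathcomp Require Import all_classical all_reals all_analysis.
Set Implicit Arguments.
Unset Strict Implicit.
Unset Printing Implicit Defensive.
Import Order.TTheory GRing.Theory Num.Theory.
Import numFieldNormedType.Exports.
Local Open Scope ring_scope.

Record kgraph (k : nat) (V : finType) := KGraph {
  edges : {set {set V}};
  edges_uniform : [forall e in edges, #|e| == k]
}.

HB.instance Definition _ (k : nat) (V : finType) := [isSub for @edges k V].
HB.instance Definition _ (k : nat) (V : finType) :=
  [Finite of kgraph k V by <:].

Definition codegree (k : nat) (V : finType) (H : kgraph k V) (S : {set V}) :
  nat := #|[set e in edges H | S \subset e]|.

(* Every codegree of a (k-1)-set is at most #|V|, so the default value #|V| is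
   inert unless #|V| < k-1, where there is no (k-1)-set at all. *)
Definition min_codegree (k : nat) (V : finType) (H : kgraph k V) : nat :=
  \big[minn/#|V|]_(S : {set V} | #|S| == k.-1) codegree H S.

(* Not necessarily induced copies. *)
Definition contains (k : nat) (V W : finType)
    (H : kgraph k W) (F : kgraph k V) : bool :=
  [exists f : {ffun V -> W},
    injectiveb f && [forall e in edges F, f @: e \in edges H]].

(* Up to isomorphism, every finite k-graph has vertex set 'I_m for some m. *)
Definition finite_family (k : nat) := seq {m : nat & kgraph k 'I_m}.

Definition family_free (k : nat) (Fs : finite_family k) (V : finType)
    (H : kgraph k V) : bool :=
  all (fun F => ~~ contains H (tagged F)) Fs.

(* The value is 0 when no n-vertex k-graph is Fs-free, which happens only if
   Fs has an edgeless member. *)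
Definition co_ex (k : nat) (n : nat) (Fs : finite_family k) : nat :=
  \max_(H : kgraph k 'I_n | family_free Fs H) min_codegree H.

Definition co_ex_ratio (R : realType) (k : nat) (Fs : finite_family k)
  (n : nat) : R := (co_ex n Fs)%:R / n%:R.

Definition codegree_turan_density (R : realType) (k : nat)
  (Fs : finite_family k) : R := limn (co_ex_ratio R Fs).

(* Main.v *)
(** Write [alpha = a / b] in lowest terms and colour vertices by Z/b.  Call a
    [k]-set good if, whenever all its vertices but [v] have the same colour [c],
    the colour of [v] lies in [{c + 1, ..., c + a}].  The forbidden family
    consists of the [k]-graphs of bounded order without a colouring making all
    edges good.  The good [k]-sets of a balanced colouring show that the density
    is at least [a / b].

    For the upper bound, take a large random sample of a [k]-graph of minimum
    codegree at least [(a / b) n].  Its colouring satisfies: for each substantial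
    colour [c], the window [{c + 1, ..., c + a}] carries about [a / b] of the
    vertices, because of a monochromatic [(k-1)]-set of colour [c].  Jumping from
    each substantial colour to the farthest one in its window must, after winding
    around the circle, have used only jumps of length exactly [a]; as [a] and [b]
    are coprime, all colours are substantial and equally so.  Hence the sample
    contains a complete blow-up of the edges of type [(c, ..., c, c + i)],
    [1 <= i <= a].  By the same circle argument, every good colouring of the
    blow-up, even together with one more vertex, is constant on each part and
    permutes the colours.  So any vertex is joined to at most [a] of [b] fixed
    [(k-1)]-sets, one in each part, and one of them has codegree at most
    [(a / b) n]. *)

Require Import Defs.
From mathcomp Require Import all_boot all_order all_algebra.
From mathcomp Require Import zify ring.
From mathcomp Require boolp.
Set Implicit Arguments.
Unset Strict Implicit.
Unset Printing Implicit Defensive.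
Import Order.TTheory GRing.Theory Num.Theory.

(** * Progressions on a circle *)

Lemma sum_periodic (b r x : nat) (w : nat -> nat) :
  (forall j, w (j + b) = w j) ->
  \sum_(x <= j < x + r * b) w j = r * \sum_(0 <= j < b) w j.
Proof.
move=> wb.
have one y : \sum_(y <= j < y + b) w j = \sum_(0 <= j < b) w j.
  elim: y => [|y <-]; first by rewrite add0n.
  case: b wb => [|b] wb; first by rewrite !addn0 !big_geq.
  rewrite addSn big_nat_recr /=; last by lia.
  by rewrite [RHS]big_ltn ?wb ?addnS 1?addnC; lia.
elim: r x => [|r IH] x; first by rewrite !mul0n addn0 big_geq.
rewrite mulSn (@big_cat_nat _ _ _ (x + b)) ?leq_addr //=; last by lia.
by rewrite one addnA IH mulSn.
Qed.

(* [w] gives the weights of the colours, unrolled from Z/b to the naturals, and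
   [D] the substantial colours; [E] and [e] are error terms. *)
Lemma circle_cover (a b W E e : nat) (w : nat -> nat) (D : pred nat) :
    coprime a b -> 0 < a -> 0 < b ->
    (forall j, w (j + b) = w j) -> (forall j, D (j + b) = D j) ->
    \sum_(0 <= j < b) w j = W ->
    (forall x, D x -> a * W <= b * (\sum_(x.+1 <= j < (x + a).+1) w j) + E) ->
    (forall x, ~~ D x -> w x <= e) ->
    b * (E + b * a * e) < W ->
  forall x, D x.
Proof.
move=> cab a0 b0 wb Db sW H1 H2 H3.
have Dm r x : D (x + r * b) = D x.
  by elim: r => [|r <-]; [rewrite addn0 | rewrite mulSn addnCA addnC Db].
have [x0 Dx0] : exists x0, D x0.
  case: (boolP [exists i : 'I_b, D i]) => [/existsP[i Di]|]; first by exists i.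
  rewrite negb_exists => /forallP nD; exfalso.
  have : W <= b * e.
    rewrite -sW big_mkord -[b in b * e]card_ord -sum_nat_const leq_sum // => i _.
    exact/H2/nD.
  have : b * e <= b * (E + b * a * e).
    rewrite leq_mul2l; apply/orP; right; apply: leq_trans (leq_addl _ _).
    by rewrite leq_pmull // muln_gt0 b0.
  by lia.
(* The jump goes to the farthest position of [D] in the window. The at most [a] positions beyond it
   lie outside [D] and weigh at most [e] each, whence the error [b * a * e]. A jump of length zero
   would leave the whole of [a * W] to the error terms. *)
have next x : exists g, D x -> [/\ 0 < g <= a, D (x + g) &
    a * W <= b * (\sum_(x.+1 <= j < (x + g).+1) w j) + (E + b * a * e)].
  case: (boolP (D x)) => [Dx|_]; last by exists 0.
  have exP : exists g, (g <= a) && D (x + g) by exists 0; rewrite addn0.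
  have ubP g : (g <= a) && D (x + g) -> g <= a by case/andP.
  case: (ex_maxnP exP ubP) => g /andP[ga Dg] gmax.
  have tl : \sum_((x + g).+1 <= j < (x + a).+1) w j <= a * e.
    apply: (@leq_trans (\sum_((x + g).+1 <= j < (x + a).+1) e)).
      rewrite !big_nat; apply: leq_sum => j jP; apply: H2; apply/negP => Dj.
      have := gmax (j - x); rewrite subnKC; last by lia.
      by rewrite Dj andbT; lia.
    by rewrite sum_nat_const_nat; nia.
  have H4 : a * W <= b * (\sum_(x.+1 <= j < (x + g).+1) w j) + (E + b * a * e).
    have := H1 x Dx; rewrite (@big_cat_nat _ _ _ (x + g).+1) /=; try lia.
    by have := leq_mul (leqnn b) tl; lia.
  exists g => _; split=> //; rewrite ga andbT lt0n; apply/eqP => g0.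
  by move: H4; rewrite g0 addn0 big_geq //; nia.
(* [f x] is the length of the jump from [x]. *)
have [f fP] := boolp.choice next.
pose X i := iter i (fun x => x + f x) x0.
have XD i : D (X i) by elim: i => //= i /fP[].
have XS i : X i.+1 = X i + f (X i) by [].
have XE i l : X i <= X (i + l) /\ X (i + l) <= X i + l * a.
  elim: l => [|l [IH1 IH2]]; first by rewrite addn0; lia.
  by rewrite addnS XS; have [/andP[? ?] _ _] := fP _ (XD (i + l)); lia.
have XW i l : l * (a * W) <=
    b * (\sum_((X i).+1 <= j < (X (i + l)).+1) w j) + l * (E + b * a * e).
  elim: l => [|l IH]; first by lia.
  have [gt0 _ H] := fP _ (XD (i + l)).
  rewrite addnS (@big_cat_nat _ _ _ (X (i + l)).+1) /=; last by lia.
    by rewrite -/(X _); lia.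
  by have [] := XE i l; lia.
(* Two of the first [b.+1] positions agree modulo [b], so the jumps between them make a whole number
   of turns. *)
have [i [j [ltij jb /eqP Xij]]] :
    exists i j, [/\ i < j, j <= b & X i == X j %[mod b]].
  pose h (i : 'I_b.+1) := Ordinal (ltn_pmod (X i) b0).
  have /injectivePn[i [j ij hij]] : ~~ injectiveb h.
    by apply/negP => /injectiveP/leq_card; rewrite !card_ord ltnn.
  have Hij : X i == X j %[mod b] by apply/eqP; case: hij.
  case: (ltngtP i j) => [lt|lt|/val_inj eq]; last by rewrite eq eqxx in ij.
    by exists i, j; split=> //; rewrite -ltnS.
  by exists j, i; split=> //; rewrite 1?eq_sym // -ltnS.
pose l := j - i; have jE : j = i + l by rewrite subnKC // ltnW.
have [leX geX] := XE i l.
have [r Xr] : exists r, X (i + l) = X i + r * b.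
  rewrite -jE in leX *; exists ((X j - X i) %/ b).
  rewrite divnK; first by rewrite subnKC.
  by rewrite -eqn_mod_dvd //; apply/eqP.
have := XW i l; rewrite Xr -addSn sum_periodic // sW => HW.
(* The [r] turns collect weight [r * W]. If [l * a] exceeded [r * b], the [l] jumps would have to
   make up a deficit of [W] from their error terms, which total less than [W]. *)
have laE : l * a = r * b.
  apply/eqP; rewrite eqn_leq; apply/andP; split; last by lia.
  rewrite leqNgt; apply/negP => lt; have lb : l <= b by lia.
  have : (r * b).+1 * W <= l * a * W by rewrite leq_mul2r lt orbT.
  have : l * (E + b * a * e) <= b * (E + b * a * e) by rewrite leq_mul2r lb orbT.
  by lia.
have lE : l = b.
  have : b %| l by rewrite -(@Gauss_dvdl b l a) 1?coprime_sym // laE dvdn_mull.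
  by move/dvdn_leq; lia.
(* Each of the [b] jumps has length at most [a] and together they cover [b * a], so none is
   shorter. *)
have XA u : u <= b -> X (i + u) = X i + u * a.
  move=> ub; have [_ H] := XE i u; have := XE (i + u) (b - u).
  rewrite -addnA subnKC // -{1 2}lE Xr -laE lE mulnBl => -[_ H'].
  have : u * a <= b * a by rewrite leq_mul2r ub orbT.
  by lia.
move=> x; have [u v uv _] := egcdnP b a0.
(* By Bezout, [u] inverts [a] modulo [b], so [y] solves [X i + y * a = x] modulo [b]. The multiple
   [b * X i] of [b] keeps the subtraction from being truncated. *)
pose y := (u * (x + b * X i - X i)) %% b.
have yb : y < b by rewrite ltn_mod.
have := XD (i + y); rewrite XA ?(ltnW yb) // => Dy.
have bX : X i <= b * X i by rewrite leq_pmull.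
have : X i + y * a = x %[mod b].
  rewrite /y -modnDmr modnMml modnDmr mulnAC uv (eqP cab) mulnDl mul1n.
  have -> : X i + (v * b * (x + b * X i - X i) + (x + b * X i - X i)) =
     (v * (x + b * X i - X i) + X i) * b + x by nia.
  by rewrite modnMDl.
rewrite -(Dm ((X i + y * a) %/ b) x) => Hm; move: Dy.
have Dmod z : D z = D (z %% b) by rewrite {1}(divn_eq z b) addnC Dm.
by rewrite Dmod Hm -Dmod Dm.
Qed.

(** * Random sampling *)

Definition reindex_ffun (I J : finType) (V : Type) (g : {ffun I -> V})
  (s : J -> I) : {ffun J -> V} := [ffun j => g (s j)].

(* Summing over [h] is the same as summing over [h] and then over all ways of
   resampling the part of [h] read by [get]: [(h, u) |-> (put h u, get h)] is an
   involution. *)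
Lemma big_resample (R : Type) (idx : R) (op : Monoid.com_law idx)
    (T U : finType) (put : T -> U -> T) (get : T -> U) (F : T -> R) :
    (forall h u, get (put h u) = u) -> (forall h u, put (put h u) (get h) = h) ->
  \big[op/idx]_h \big[op/idx]_u F (put h u) = \big[op/idx]_h \big[op/idx]_(u : U) F h.
Proof.
move=> gp pp; rewrite !pair_big /=.
pose sw (p : T * U) := (put p.1 p.2, get p.1).
have swK : involutive sw by case=> h u; rewrite /sw /= gp pp.
by rewrite (reindex_inj (inv_inj swK)); apply: eq_bigr => -[h u] _ /=; rewrite pp.
Qed.

(** In probabilistic terms: [get h] is uniform on [U] when [h] is uniform on [T]. *)
Lemma card_resample (T U : finType) (put : T -> U -> T) (get : T -> U)
    (B : pred U) :
    (forall h u, get (put h u) = u) -> (forall h u, put (put h u) (get h) = h) ->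
  #|[pred h | B (get h)]| * #|U| = #|B| * #|T|.
Proof.
move=> gp pp; have := big_resample addn (fun h => nat_of_bool (B (get h))) gp pp.
rewrite (eq_bigr (fun _ => #|B|)) => [|h _]; last first.
  rewrite -sum1_card [RHS]big_mkcond; apply: eq_bigr => u _.
  by rewrite gp unfold_in; case: (B u).
rewrite sum_nat_const mulnC => ->.
rewrite -sum1_card big_mkcond big_distrl /=; apply: eq_bigr => h _ /=.
by rewrite inE sum_nat_const; case: (B _); rewrite ?mul1n ?muln1 ?muln0 ?mul0n.
Qed.

Section FfunResample.
Variables (I J : finType) (V : finType).

Definition set_coord (i : I) (g : {ffun I -> V}) (u : V) : {ffun I -> V} :=
  [ffun j => if j == i then u else g j].

Lemma set_coord_get i g u : set_coord i g u i = u.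
Proof. by rewrite ffunE eqxx. Qed.

Lemma set_coordK i g u : set_coord i (set_coord i g u) (g i) = g.
Proof. by apply/ffunP => j; rewrite !ffunE; case: eqP => // ->. Qed.

Definition set_coords (x : J -> I) (h : {ffun I -> V}) (u : {ffun J -> V}) :
    {ffun I -> V} :=
  [ffun i => if [pick j | x j == i] is Some j then u j else h i].

Lemma set_coords_get x h u : injective x -> reindex_ffun (set_coords x h u) x = u.
Proof.
move=> xI; apply/ffunP => j; rewrite !ffunE; case: pickP => [j'|/(_ j)].
  by move/eqP/xI->.
by rewrite eqxx.
Qed.

(** Once the coordinates other than [i] are fixed, exactly one value at [i] coincides with [g j]. *)
Lemma card_coincidence (i j : I) : i != j ->
  #|[pred g : {ffun I -> V} | g i == g j]| * #|V| = #|{ffun I -> V}|.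
Proof.
move=> ij; have ji : (j == i) = false by rewrite eq_sym (negbTE ij).
have := big_resample addn (fun g : {ffun I -> V} => nat_of_bool (g i == g j))
  (set_coord_get i) (set_coordK i).
rewrite (eq_bigr (fun _ => 1)) => [|g _]; last first.
  rewrite (bigD1 (g j)) //= big1 => [|u ug].
    by rewrite !ffunE eqxx ji eqxx.
  by rewrite !ffunE eqxx ji (negbTE ug).
rewrite sum1_card => ->; rewrite -sum1_card big_mkcond big_distrl /=.
apply: eq_bigr => h _; rewrite inE sum_nat_const.
by case: (_ == _); rewrite ?mul1n ?muln1 ?muln0 ?mul0n.
Qed.

(** Union bound over the ordered pairs of distinct indices. *)
Lemma card_noninj (s : J -> I) : injective s ->
  #|[pred g : {ffun I -> V} | ~~ injectiveb (reindex_ffun g s)]| * #|V|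
    <= #|J| ^ 2 * #|{ffun I -> V}|.
Proof.
move=> sI; pose P (p : J * J) := p.1 != p.2.
apply: (@leq_trans (\sum_(p | P p)
    #|[pred g : {ffun I -> V} | g (s p.1) == g (s p.2)]| * #|V|)).
  rewrite -big_distrl leq_mul2r; apply/orP; right.
  rewrite -sum1_card; under [X in _ <= X]eq_bigr do rewrite -sum1_card big_mkcond.
  rewrite exchange_big /= big_mkcond leq_sum // => g _; case: ifP => //.
  case/injectivePn=> i [j ij]; rewrite !ffunE => gij.
  by rewrite (bigD1 (i, j)) //= inE /= gij eqxx.
under eq_bigr => p pP do rewrite card_coincidence ?(inj_eq sI) //.
rewrite sum_nat_const leq_mul2r; apply/orP; right.
by apply: leq_trans (max_card _) _; rewrite card_prod.
Qed.

End FfunResample.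

Section Sampling.
Local Open Scope ring_scope.

(** Lower bound on the squared deviation at a bad sample, where the centred sum falls short of zero
    by at least [n * m / (2 * q)]. *)
Lemma square_gap (n m q X D M : nat) :
    (n * m + 2 * n * q * X <= 2 * q * D * M)%N ->
  (n ^ 2 * m ^ 2)%:Z <= (4 * q ^ 2)%:Z * (n%:Z *+ X - D%:Z *+ M) ^+ 2.
Proof.
rewrite -lez_nat !PoszD !PoszM -[n%:Z *+ X]mulr_natr -[D%:Z *+ M]mulr_natr.
rewrite !natz => key.
have kz : n%:Z * m%:Z <= 2%:Z * q%:Z * (D%:Z * M%:Z - n%:Z * X%:Z).
  rewrite -subr_ge0 in key; rewrite -subr_ge0; move: key; congr (0 <= _); ring.
have := ler_pM (_ : 0 <= n%:Z * m%:Z) (_ : 0 <= n%:Z * m%:Z) kz kz.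
move/(_ isT isT); congr (_ <= _); rewrite ?PoszM ?expnS ?expn0 ?PoszM; ring.
Qed.

Lemma second_moment_bound (B n m q N : nat) : (0 < n)%N -> (0 < m)%N ->
    (B * (n ^ 2 * m ^ 2))%:Z <= (4 * q ^ 2)%:Z * (n%:Z ^+ 2 *+ N *+ m) ->
  (B * m <= 4 * q ^ 2 * N)%N.
Proof.
move=> n0 m0 H; rewrite -(leq_pmul2r (_ : 0 < n ^ 2 * m)%N).
  rewrite -lez_nat; move: H.
  rewrite -[_ *+ m]mulr_natr -[_ *+ N]mulr_natr !natz.
  congr (_ <= _); rewrite !PoszM ?expnS ?expn0 ?PoszM; ring.
by rewrite muln_gt0 expn_gt0 n0.
Qed.

Variables (V : finType) (m K : nat).

(* For [v != v'], resampling [g v] averages the cross terms out, since [y u] has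
   mean zero. *)
Lemma second_moment (s : 'I_K -> 'I_m) (y : {ffun 'I_K -> V} -> V -> int) (c : int) :
    (0 < #|V|)%N -> 0 <= c ->
    (forall u, \sum_v y u v = 0) -> (forall u v, y u v ^+ 2 <= c) ->
  \sum_(g : {ffun 'I_m -> V})
    (\sum_(v | v \notin codom s) y (reindex_ffun g s) (g v)) ^+ 2
    <= (c *+ #|{ffun 'I_m -> V}|) *+ m.
Proof.
move=> V0 c0 y0 yc; pose f (g : {ffun 'I_m -> V}) v := y (reindex_ffun g s) (g v).
under eq_bigr do rewrite expr2 big_distrlr /=.
rewrite exchange_big /=.
have -> : (c *+ #|{ffun 'I_m -> V}|) *+ m =
          \sum_(v < m) (c *+ #|{ffun 'I_m -> V}|) by rewrite sumr_const card_ord.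
rewrite big_mkcond; apply: ler_sum => v _; case: ifP => [vs|_]; last exact: mulrn_wge0.
rewrite exchange_big (bigD1 v) //= [X in _ + X]big1 ?addr0 => [|v' /andP[v's v'v]].
  by rewrite -sumr_const; apply: ler_sum => g _; rewrite -expr2 yc.
have := big_resample +%R (fun g : {ffun 'I_m -> V} => f g v * f g v')
  (set_coord_get v) (set_coordK v).
rewrite [LHS]big1 => [|g _].
  under eq_bigr do rewrite sumr_const.
  rewrite sumrMnl => /esym/eqP; rewrite mulrn_eq0 => /orP[|/eqP//].
  by rewrite cardT -cardE; case: #|V| V0.
rewrite (eq_bigr (fun u => y (reindex_ffun g s) u * f g v')) => [|u _].
  by rewrite -big_distrl /= y0 mul0r.
have cs : reindex_ffun (set_coord v g u) s = reindex_ffun g s.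
  by apply/ffunP => i; rewrite !ffunE; case: eqP vs => // <-; rewrite codom_f.
by rewrite /f cs set_coord_get ffunE (negbTE v'v).
Qed.

(** Chebyshev's inequality: once the coordinates read by [s] are fixed, the others are independent,
    and the observed degree rarely falls [m / q] below its expected share. *)
Lemma card_low_degree (s : 'I_K -> 'I_m) (E : {ffun 'I_K -> V} -> V -> bool)
    (a b q : nat) :
    injective s -> (0 < #|V|)%N -> (0 < a <= b)%N -> (0 < q)%N -> (2 * q * K <= m)%N ->
    (forall u : {ffun 'I_K -> V}, injective u ->
      (a * #|V| <= b * #|[pred v | E u v]|)%N) ->
    (forall (u : {ffun 'I_K -> V}) i, ~~ E u (u i)) ->
  (#|[pred g : {ffun 'I_m -> V} | injectiveb (reindex_ffun g s) &&
      (b * q * #|[pred v | E (reindex_ffun g s) (g v)]| + b * m < a * q * m)]| * m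
    <= 4 * q ^ 2 * #|{ffun 'I_m -> V}|)%N.
Proof.
move=> sI V0 /andP[a0 ab] q0 mK Ed Eu; set n := #|V| in V0 Ed *.
case: (posnP m) => [/eqP m0|m0].
  by apply: (@leq_trans 0) => //; rewrite leqn0 muln_eq0 m0 orbT.
have sumP (T : finType) (P : pred T) : (\sum_v P v)%N = #|[pred v | P v]|.
  by rewrite -sum1_card [RHS]big_mkcond; apply: eq_bigr => v _; rewrite inE; case: (P v).
pose d u := #|[pred v | E u v]|.
(* On injective tuples this is the indicator of [E u], centred and multiplied by [n] to stay
   integral. *)
pose y (u : {ffun 'I_K -> V}) v : int :=
  if injectiveb u then n%:Z *+ E u v - (d u)%:Z else 0.
have dn u : (d u <= n)%N by exact: max_card.
have yn u v : y u v ^+ 2 <= n%:Z ^+ 2.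
  rewrite /y; case: ifP => _; last by rewrite expr0n sqr_ge0.
  have := dn u; case: (E u v); rewrite ?mulr1n ?mulr0n => ?; nia.
have y0 u : \sum_v y u v = 0.
  rewrite /y; case: (injectiveb u); last by rewrite big1.
  rewrite sumrB sumr_const sumrMnr sumP cardT -cardE -/n -/(d u).
  by lia.
have := second_moment s V0 (sqr_ge0 n%:Z) y0 yn.
set bad := [pred g | _].
have H (g : {ffun 'I_m -> V}) : bad g ->
    (n ^ 2 * m ^ 2)%:Z <= (4 * q ^ 2)%:Z *
     (\sum_(v | v \notin codom s) y (reindex_ffun g s) (g v)) ^+ 2.
  case/andP=> gI lowX; rewrite /y gI.
  set X := #|_| in lowX.
  rewrite sumrB sumr_const.
  have -> : #|[pred v | v \notin codom s]| = (m - K)%N.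
    have := cardC [pred v | v \in codom s]; rewrite card_ord.
    have -> : #|[pred v | v \in codom s]| = K.
      by rewrite -[RHS]card_ord -(card_codom sI); apply: eq_card => v; rewrite inE.
    have -> : #|[pred v | v \notin codom s]| = #|[predC [pred v | v \in codom s]]|.
      by apply: eq_card => v; rewrite !inE.
    by lia.
  have -> : \sum_(v | v \notin codom s) n%:Z *+ E (reindex_ffun g s) (g v) = n%:Z *+ X.
    rewrite big_mkcond /= (eq_bigr (fun v => n%:Z *+ E (reindex_ffun g s) (g v))).
      by rewrite sumrMnr sumP.
    move=> v _; case: ifP => // /negbFE/codomP[i ->].
    have := Eu (reindex_ffun g s) i; rewrite ffunE => /negbTE ->.
    by rewrite mulr0n.
  have := Ed _ (injectiveP _ gI); rewrite -/(d _); have := dn (reindex_ffun g s).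
  move: (d _) => D Dn aD.
  have [M mE] : exists M, (m = M + K)%N by exists (m - K)%N; nia.
  have -> : (m - K = M)%N by lia.
  (* Only the [M = m - K] coordinates outside [s] are random. Half of the slack [m / q] pays for the
     other [K], since [2 * q * K <= m]. *)
  have key : (n * m + 2 * n * q * X <= 2 * q * D * M)%N.
    rewrite -(leq_pmul2l (_ : 0 < b)%N); last by lia.
    have h1 := leq_mul (leqnn (2 * n)) lowX.
    have h2 := leq_mul (leqnn (2 * q * M)) aD.
    have h3 := leq_mul (leqnn (n * b)) mK.
    have h4 := leq_mul (leqnn (2 * q * n * K)) ab.
    by move: h1 h2 h3 h4; rewrite mE; nia.
  exact: square_gap.
move=> S.
have {}S : ((#|bad| * (n ^ 2 * m ^ 2))%:Z <=
    (4 * q ^ 2)%:Z * (n%:Z ^+ 2 *+ #|{ffun 'I_m -> V}| *+ m))%R.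
  have q2 : 0 <= (4 * q ^ 2)%:Z by [].
  apply: le_trans (ler_wpM2l q2 S).
  rewrite mulr_sumr -sum1_card big_distrl /= (big_morph _ PoszD (erefl _)).
  rewrite big_mkcond; apply: ler_sum => g _; case: ifP => [/H|_].
    by rewrite mul1n.
  by rewrite mulr_ge0 // sqr_ge0.
exact: second_moment_bound S.
Qed.

(** Some [g] has at most the average number of low tuples. In [2 * K ^ 2 + 4 * q ^ 2], one [K ^ 2]
    pays for the non-injective [s], the other for the injective [s] on which [g] repeats a value,
    and [4 * q ^ 2] comes from Chebyshev. *)
Lemma sampling (E : {ffun 'I_K -> V} -> V -> bool) (a b q Q : nat) :
    (0 < a <= b)%N -> (0 < q)%N -> (0 < m <= #|V|)%N -> (2 * q * K <= m)%N ->
    (Q * (2 * K ^ 2 + 4 * q ^ 2) <= m)%N ->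
    (forall u : {ffun 'I_K -> V}, injective u ->
      (a * #|V| <= b * #|[pred v | E u v]|)%N) ->
    (forall (u : {ffun 'I_K -> V}) i, ~~ E u (u i)) ->
  exists g : {ffun 'I_m -> V}, (Q * #|[pred s : {ffun 'I_K -> 'I_m} |
      b * q * #|[pred v | E (reindex_ffun g s) (g v)]| + b * m < a * q * m]|
    <= m ^ K)%N.
Proof.
move=> ab q0 /andP[m0 mV] mK mQ Ed Eu.
pose low (g : {ffun 'I_m -> V}) (s : {ffun 'I_K -> 'I_m}) :=
  (b * q * #|[pred v | E (reindex_ffun g s) (g v)]| + b * m < a * q * m)%N.
pose N := #|{ffun 'I_m -> V}|.
have V0 : (0 < #|V|)%N by lia.
have N0 : (0 < N)%N by rewrite /N card_ffun expn_gt0 V0.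
have bound (s : {ffun 'I_K -> 'I_m}) : (m * #|[pred g | low g s]| <=
    (~~ injectiveb s) * (m * N) + (K ^ 2 + 4 * q ^ 2) * N)%N.
  have [/injectiveP sI|_] := boolP (injectiveb s); last first.
    rewrite mul1n; apply: leq_trans (leq_addr _ _).
    by rewrite leq_mul2l max_card orbT.
  have h1 := card_noninj V sI; rewrite card_ord -/N in h1.
  have h2 := card_low_degree sI V0 ab q0 mK Ed Eu; rewrite -/N in h2.
  set A := #|_| in h1; set B := #|_| in h2.
  have AB : (#|[pred g | low g s]| <= A + B)%N.
    rewrite /A /B -cardUI; apply: leq_trans (leq_addr _ _).
    apply: subset_leq_card; apply/subsetP => g; rewrite !inE /low => ->.
    by rewrite andbT orNb.
  have := leq_mul (leqnn A) mV; have := leq_mul (leqnn m) AB.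
  by lia.
have cs : (#|[pred s : {ffun 'I_K -> 'I_m} | ~~ injectiveb s]| * m <= K ^ 2 * m ^ K)%N.
  have := @card_noninj 'I_K 'I_K 'I_m id (fun _ _ e => e).
  rewrite !card_ord card_ffun !card_ord.
  congr (_ * _ <= _)%N; apply: eq_card => s; rewrite !inE.
  by have -> : reindex_ffun s id = s by apply/ffunP => i; rewrite ffunE.
have tot : (m * \sum_g #|[pred s | low g s]| <= (2 * K ^ 2 + 4 * q ^ 2) * m ^ K * N)%N.
  have -> : (\sum_g #|[pred s | low g s]| = \sum_s #|[pred g | low g s]|)%N.
    under eq_bigr do rewrite -sum1_card big_mkcond.
    rewrite exchange_big /=; apply: eq_bigr => s _.
    by rewrite -sum1_card [RHS]big_mkcond.
  rewrite big_distrr /=.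
  apply: (@leq_trans (\sum_(s : {ffun 'I_K -> 'I_m})
    ((~~ injectiveb s) * (m * N) + (K ^ 2 + 4 * q ^ 2) * N))%N).
    by apply: leq_sum => s _; exact: bound.
  rewrite big_split /= sum_nat_const card_ffun !card_ord -big_distrl /=.
  have -> : (\sum_(s : {ffun 'I_K -> 'I_m}) ~~ injectiveb s)%N =
      #|[pred s : {ffun 'I_K -> 'I_m} | ~~ injectiveb s]|.
    rewrite -sum1_card [RHS]big_mkcond; apply: eq_bigr => s _.
    by rewrite inE; case: (~~ _).
  by have := leq_mul cs (leqnn N); lia.
case: (boolP [exists g, Q * #|[pred s | low g s]| <= m ^ K]%N) => [/existsP//|].
rewrite negb_exists => /forallP nog; exfalso.
have : (N * (m ^ K).+1 <= Q * \sum_g #|[pred s | low g s]|)%N.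
  rewrite /N -sum_nat_const big_distrr /=; apply: leq_sum => g _.
  by rewrite ltnNge nog.
move=> h; have h1 := leq_mul (leqnn m) h; have h2 := leq_mul (leqnn Q) tot.
have h3 := leq_mul mQ (leqnn (m ^ K * N)).
have : (0 < m * N)%N by rewrite muln_gt0 m0.
by nia.
Qed.

End Sampling.

(** * Colour patterns on Z/b *)

Lemma sum_card_fibre (I V : finType) (f : V -> I) (P : pred I) :
  \sum_(c | P c) #|[pred v | f v == c]| = #|[pred v | P (f v)]|.
Proof.
rewrite -[RHS]sum1_card [RHS](partition_big f P) //=; apply: eq_bigr => c Pc.
rewrite -sum1_card; apply: eq_bigl => v; rewrite !inE.
by case: eqP => [->|]; rewrite ?Pc ?andbF.
Qed.

Section Ahead.
Variables (n a : nat).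

(** The difference is taken in Z/b, with [b = n.+1], and only then compared as a natural number. *)
Definition ahead (c d : 'I_n.+1) : bool := 0 < (d - c)%R <= a.

Lemma aheadxx c : ahead c c = false.
Proof. by rewrite /ahead subrr. Qed.

Hypothesis an : a < n.+1.

Lemma ahead_sum (w : 'I_n.+1 -> nat) j :
  \sum_(d | ahead (inZp j) d) w d = \sum_(j.+1 <= i < (j + a).+1) w (inZp i).
Proof.
rewrite (reindex_inj (addrI (inZp j))) /=.
rewrite (eq_bigl (fun x : 'I_n.+1 => 0 < x <= a)) => [|x]; last first.
  by rewrite /ahead addrAC subrr add0r.
rewrite (eq_bigr (fun x : 'I_n.+1 => w (inZp (j + x)))) => [|x _]; last first.
  by congr w; apply/val_inj; rewrite /= modnDml.
rewrite -(big_mkord (fun x => 0 < x <= a) (fun x => w (inZp (j + x)))).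
rewrite -[X in _ = \sum_(X <= _ < _) _]add0n big_addn subSS addKn.
rewrite (eq_bigl (fun x => (0 < x) && (x < a.+1))) //.
rewrite -(big_nat_widen 0 a.+1 n.+1 (fun x => 0 < x)) //.
rewrite big_ltn_cond //= big_add1 /= big_mkcond /=.
by apply: eq_bigr => i _; congr (w (inZp _)); lia.
Qed.

Lemma card_ahead c : #|[pred d | ahead c d]| = a.
Proof.
rewrite -sum1_card -{1}(valZpK c) ahead_sum sum_nat_const_nat muln1; lia.
Qed.

Lemma card_aheadl d : #|[pred c | ahead c d]| = a.
Proof.
rewrite -(card_ahead (- d)%R) -!sum1_card (reindex_inj (@oppr_inj _)) /=.
by apply: eq_bigl => c; rewrite !inE /ahead opprK addrC opprK.
Qed.

Lemma circle_cover_ord (W E e : nat) (w : 'I_n.+1 -> nat) (D : pred 'I_n.+1) :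
    coprime a n.+1 -> 0 < a -> \sum_c w c = W ->
    (forall x, D x -> a * W <= n.+1 * (\sum_(d | ahead x d) w d) + E) ->
    (forall x, ~~ D x -> w x <= e) ->
    n.+1 * (E + n.+1 * a * e) < W ->
  forall x, D x.
Proof.
move=> co a0 sW H1 H2 H3 x; rewrite -(valZpK x).
have per j : inZp (j + n.+1) = inZp j :> 'I_n.+1 by apply/val_inj; rewrite /= modnDr.
apply: (circle_cover (w := fun j => w (inZp j)) (D := fun j => D (inZp j))
   co a0 _ _ _ _ _ _ H3) => //= [j|j||j Dj|j nD].
- by rewrite per.
- by rewrite per.
- by rewrite big_mkord -sW; apply: eq_bigr => i _; rewrite valZpK.
- by rewrite -ahead_sum; apply: H1.
- exact: H2.
Qed.

(* A proper nonempty arc is not invariant under any nonzero rotation. *)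
Lemma ahead_sub_eq c d : 0 < a ->
  (forall x, ahead x c -> ahead x d) -> c = d.
Proof.
move=> a0 H; apply/esym/eqP; rewrite -subr_eq0; apply/eqP.
set z := (d - c)%R.
have Hi (i : nat) : 0 < i <= a -> 0 < (z + i) %% n.+1 <= a.
  move=> ia; have i1 : i < n.+1 by lia.
  have := H (c - Ordinal i1)%R; rewrite /ahead !opprB.
  rewrite addrCA subrr addr0 => /(_ ia).
  by rewrite addrA addrAC.
case: (posnP z) => [z0|z0]; first exact/val_inj.
have zn := ltn_ord z; exfalso.
(* The rotation by [z] sends [n.+1 - z] to zero if this point is in the arc; otherwise it pushes [a]
   past the end of the arc without wrapping round. *)
case: (leqP (n.+1 - z) a) => h.
  by have := Hi (n.+1 - z); rewrite subnKC ?modnn; lia.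
by have := Hi a; rewrite modn_small; lia.
Qed.

(** Here [psi c j] is the colour of the [j]-th vertex of part [c]. By pigeonhole some colour [p d]
    occurs [K] times in part [d], so every part ahead of [d] is coloured ahead of [p d]. The circle
    argument makes [p] a permutation, and the colours whose windows contain a given colour determine
    it. *)
Lemma rigid_colouring (K t : nat) (psi : 'I_n.+1 -> 'I_t -> 'I_n.+1) :
    coprime a n.+1 -> 0 < a -> 0 < K -> n.+1 * K <= t ->
    (forall d c (x : {ffun 'I_K -> 'I_t}), injective x -> (forall i, psi d (x i) = c) ->
       forall e j, ahead d e -> ahead c (psi e j)) ->
  exists2 p : 'I_n.+1 -> 'I_n.+1, injective p & forall c j, psi c j = p c.
Proof.
move=> co a0 K0 tK Hpsi.
have maj d : exists c, K <= #|[pred j | psi d j == c]|.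
  apply/existsP; apply: contraT; rewrite negb_exists => /forallP Hc.
  have : t <= n.+1 * K.-1.
    rewrite -[leqLHS]card_ord -sum1_card (partition_big (psi d) xpredT) //=.
    rewrite -[X in X * _]card_ord -sum_nat_const; apply: leq_sum => c _.
    by rewrite sum1_card -ltnS (prednK K0) ltnNge; exact: Hc.
  by nia.
have [p pP] := fin_all_exists maj.
have mono d e j : ahead d e -> ahead (p d) (psi e j).
  pose x : {ffun 'I_K -> 'I_t} := [ffun i => enum_val (widen_ord (pP d) i)].
  apply: (Hpsi d (p d) x) => [i i'|i].
    by rewrite !ffunE => /enum_val_inj/(congr1 val) /= /val_inj.
  by rewrite ffunE; have := enum_valP (widen_ord (pP d) i); rewrite inE => /eqP.
have hit d : exists j, psi d j = p d.
  have := pP d; case: (pickP [pred j | psi d j == p d]) => [j /eqP <-|no].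
    by exists j.
  by rewrite eq_card0 //; lia.
have parc d e : ahead d e -> ahead (p d) (p e).
  by move=> de; have [j <-] := hit e; exact: mono.
pose w c := #|[pred d | p d == c]|.
have onto c : 0 < w c.
  (* The image of [p], weighted by multiplicities, satisfies the hypotheses of the
     circle argument without error terms. *)
  apply: (@circle_cover_ord n.+1 0 0 w (fun c => 0 < w c)) => //=.
  - by rewrite sum_card_fibre eq_cardT // -cardE card_ord.
  - move=> x /card_gt0P[d]; rewrite inE => /eqP <-.
    rewrite addn0 mulnC leq_mul2l sum_card_fibre -[leqLHS](card_ahead d).
    apply/orP; right.
    by apply: subset_leq_card; apply/subsetP => e; rewrite !inE; exact: parc.
  - by move=> x; rewrite -leqNgt.
  - by rewrite !muln0.
have psurj c : exists d, p d = c.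
  by have /card_gt0P[d] := onto c; rewrite inE => /eqP; exists d.
have pI : injective p.
  have [p' pK] := fin_all_exists psurj.
  have p'I : injective p' by exact: can_inj pK.
  by have [q qK Kq] := injF_bij p'I; move=> x y; rewrite -(Kq x) -(Kq y) !pK => ->.
(* [p] maps the window of [x] into that of [p x]; both have [a] elements, so the implication
   reverses. *)
have arcp x d : ahead (p x) (p d) = ahead x d.
  have : [pred e | ahead x e] =i [pred e | ahead (p x) (p e)].
    apply/subset_cardP; last by apply/subsetP => e; rewrite !inE; exact: parc.
    rewrite card_ahead -(card_ahead (p x)) -!sum1_card (reindex_inj pI) /=.
    by apply: eq_bigl => e; rewrite !inE.
  by move/(_ d); rewrite !inE.
exists p => // c j; have [d dE] := psurj (psi c j); rewrite -dE; congr p.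
apply/esym/ahead_sub_eq => // x xc; rewrite -arcp dE; exact: mono xc.
Qed.

End Ahead.

(** * Good colourings and the forbidden family *)

Definition good (n a : nat) (V : finType) (chi : V -> 'I_n.+1) (e : {set V}) :=
  [forall v in e, forall c,
    [forall u in e :\ v, chi u == c] ==> ahead a c (chi v)].

Definition colourable (n a k : nat) (V : finType) (H : kgraph k V) :=
  [exists chi : {ffun V -> 'I_n.+1}, [forall e in edges H, good a chi e]].

Definition obstructions (n a k N : nat) : finite_family k :=
  [seq F <- flatten
    [seq [seq Tagged (fun m => kgraph k 'I_m) F | F <- enum {: kgraph k 'I_m}]
    | m <- iota 0 N]
  | ~~ colourable n a (tagged F)].

Section Pattern.
Variables (n a : nat).

Lemma goodP (V : finType) (chi : V -> 'I_n.+1) (e : {set V}) :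
  reflect (forall v c, v \in e -> (forall u, u \in e -> u != v -> chi u = c) ->
             ahead a c (chi v)) (good a chi e).
Proof.
apply: (iffP forall_inP) => [H v c ve uc | H v ve].
  have /forallP/(_ c)/implyP := H v ve; apply.
  by apply/forall_inP => u; rewrite !inE => /andP[uv ue]; rewrite uc.
apply/forallP => c; apply/implyP => /forall_inP uc; apply: H => // u ue uv.
by apply/eqP/uc; rewrite !inE uv.
Qed.

Lemma good_imset (U V : finType) (f : U -> V) (chi : V -> 'I_n.+1) (e : {set U}) :
  injective f -> good a chi (f @: e) = good a (chi \o f) e.
Proof.
move=> fI; apply/goodP/goodP => H v c ve uc.
  apply: H; first exact: imset_f.
  by move=> _ /imsetP[u ue ->]; rewrite (inj_eq fI); exact: uc.
case/imsetP: ve uc => {}v ve -> uc; apply: H => // u ue uv.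
by apply: uc; rewrite ?imset_f ?(inj_eq fI).
Qed.

Lemma mem_obstructions k N m (F : kgraph k 'I_m) :
  (Tagged (fun m => kgraph k 'I_m) F \in obstructions n a k N) =
  (m < N) && ~~ colourable n a F.
Proof.
rewrite mem_filter andbC; congr (_ && _).
apply/flattenP/idP => [[_ /mapP[m' m'N ->] /mapP[F' _ /(congr1 tag) /= ->]]|mN].
  by rewrite mem_iota in m'N.
exists [seq Tagged (fun m => kgraph k 'I_m) F | F <- enum {: kgraph k 'I_m}].
  by apply/mapP; exists m; rewrite ?mem_iota.
by apply/mapP; exists F; rewrite ?mem_enum.
Qed.

Lemma colourable_free k N (V : finType) (H : kgraph k V) :
  colourable n a H -> family_free (obstructions n a k N) H.
Proof.
case/existsP => chi /forall_inP Hchi; apply/allP => F.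
rewrite mem_filter => /andP[ncF _]; apply: contra ncF.
case/existsP => f /andP[/injectiveP fI /forall_inP Hf].
apply/existsP; exists [ffun v => chi (f v)]; apply/forall_inP => e eF.
have := Hchi _ (Hf e eF); rewrite good_imset //.
move/goodP => g; apply/goodP => v c ve uc; rewrite ffunE; apply: g => // u ue uv.
by rewrite -(uc u) // ffunE.
Qed.

(** The subgraph induced on [U], relabelled by ['I_#|U|], is small enough to be forbidden if it had
    no good colouring. *)
Lemma local_colouring k N (V : finType) (H : kgraph k V) (U : {set V}) :
    family_free (obstructions n a k N) H -> #|U| < N ->
  exists chi : V -> 'I_n.+1, forall e, e \in edges H -> e \subset U -> good a chi e.
Proof.
move=> Hfree UN; pose f (i : 'I_#|U|) := enum_val i.
have fI : injective f by exact: enum_val_inj.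
pose E := [set e : {set 'I_#|U|} | (#|e| == k) && (f @: e \in edges H)].
have Eu : [forall e in E, #|e| == k].
  by apply/forall_inP => e; rewrite inE => /andP[].
pose F := KGraph Eu.
have : colourable n a F.
  apply: contraT => ncF.
  have : Tagged (fun m => kgraph k 'I_m) F \in obstructions n a k N.
    by rewrite mem_obstructions UN.
  move/(allP Hfree)/negP; case; apply/existsP; exists [ffun i => f i].
  apply/andP; split; first by apply/injectiveP => i j; rewrite !ffunE => /fI.
  apply/forall_inP => e; rewrite inE => /andP[_].
  suff -> : f @: e = [set [ffun i => f i] x | x in e] by [].
  by apply: eq_imset => i; rewrite ffunE.
case/existsP => chi0 /forall_inP Hchi.
(* The colour outside [U] is arbitrary, as only edges inside [U] are concerned. *)
pose chi v := if [pick i | f i == v] is Some i then chi0 i else ord0.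
have chif i : chi (f i) = chi0 i.
  by rewrite /chi; case: pickP => [j /eqP/fI->|/(_ i)] //; rewrite eqxx.
exists chi => e eH eU.
have eE : e = f @: (f @^-1: e).
  apply/setP => v; apply/idP/imsetP => [ve|[i]]; last by rewrite inE => ? ->.
  have vU := subsetP eU _ ve; exists (enum_rank_in vU v); last first.
    by rewrite /f enum_rankK_in.
  by rewrite inE /f enum_rankK_in.
have : f @^-1: e \in E.
  rewrite inE -eE eH andbT -(card_imset _ fI) -eE.
  exact: (forall_inP (edges_uniform H)).
move/Hchi/goodP => g; rewrite eE good_imset //; apply/goodP => v c ve uc.
by rewrite /= chif; apply: g => // u ue uv; rewrite -chif; exact: uc.
Qed.

Lemma codegreeE K (V : finType) (H : kgraph K.+1 V) (S : {set V}) :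
  #|S| = K -> codegree H S = #|[pred v | v |: S \in edges H]|.
Proof.
move=> SK; have vS v : v |: S \in edges H -> v \notin S.
  move=> vH; apply/negP => vS; have /forall_inP/(_ _ vH) := edges_uniform H.
  by rewrite (setUidPr _) ?sub1set // SK; lia.
rewrite /codegree -(card_in_imset (f := fun v => v |: S)
  (D := [pred v | v |: S \in edges H])).
  apply: eq_card => e; rewrite inE; apply/andP/imsetP => [[eH Se]|[v vH ->]]; last first.
    by rewrite subsetUr; rewrite inE in vH.
  have /forall_inP/(_ _ eH)/eqP eK := edges_uniform H.
  have /cards1P[v ev] : #|e :\: S| == 1 by rewrite cardsDS // eK SK subSnn.
  have eE : v |: S = e by rewrite -ev setUC -{1}(setIidPr Se) setID.
  by exists v; rewrite ?inE eE.
move=> v v'; rewrite !inE => vH v'H /setP/(_ v); rewrite !inE eqxx /=.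
by rewrite (negbTE (vS _ vH)) orbF => /esym/eqP.
Qed.

End Pattern.

(** * Gadgets *)

(** The coordinates [x j] and [i0] are pairwise distinct, so the values of a random [h] there are
    jointly uniform. *)
Lemma card_resample_tuple (I J V : finType) (x : J -> I) (i0 : I)
    (B : pred ({ffun J -> V} * V)) :
    injective x -> (forall j, x j != i0) ->
  #|[pred h : {ffun I -> V} | B (reindex_ffun h x, h i0)]| * (#|V| ^ #|J| * #|V|) =
  #|B| * #|{ffun I -> V}|.
Proof.
move=> xI xi0.
pose put (h : {ffun I -> V}) (u : {ffun J -> V} * V) :=
  set_coord i0 (set_coords x h u.1) u.2.
have gp h u : (reindex_ffun (put h u) x, put h u i0) = u.
  case: u => u v; congr pair; last by rewrite /put set_coord_get.
  apply/ffunP => j; rewrite ffunE /put ffunE (negbTE (xi0 j)).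
  by have /ffunP/(_ j) := set_coords_get h u xI; rewrite ffunE.
have pp h u : put (put h u) (reindex_ffun h x, h i0) = h.
  apply/ffunP => i; rewrite /put /= !ffunE; case: eqP => [->//|_].
  by case: pickP => [j /eqP<-|no]; rewrite ?ffunE.
rewrite -(card_ffun J V); have := card_resample B gp pp; rewrite card_prod; exact.
Qed.

(* [Rel s v] stands for the statement that [s] and [v] form an edge, in a sample of size [m]
   coloured by [phi].  The classes have weight at least [m / p], degrees are
   accurate up to [m / q] except for a proportion [1 / Q] of the tuples, and a
   random map into the sample respects the colours with probability at least
   [p ^ - (b * t)]; this forces the choice of [q]. *)
Section ColouredGadget.
Variables (n a K t p q Q m : nat).
Local Notation b := n.+1.
Local Notation con := ({: 'I_b * {ffun 'I_K -> 'I_t} * ('I_b * 'I_t)}).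
Hypothesis (co : coprime a b) (a0 : 0 < a) (ab : a < b).
Hypothesis (pE : p = 2 * b ^ 3) (q_ge : 2 * b ^ 2 <= q).
Hypothesis (q_gt : p ^ (b * t) * (b * t ^ K * (b * t)) * b.+1 < q).
Hypothesis (Q_ge : q <= Q) (Q_gt : p ^ K < Q) (m0 : 0 < m).
Variables (phi : 'I_m -> 'I_b) (Rel : {ffun 'I_K -> 'I_m} -> 'I_m -> bool).
Hypothesis Rel_ahead : forall (s : {ffun 'I_K -> 'I_m}) c v,
  (forall i, phi (s i) = c) -> Rel s v -> ahead a c (phi v).
Let deg s := #|[pred v | Rel s v]|.
Let low s := b * q * deg s + b * m < a * q * m.
Hypothesis low_rare : Q * #|[pred s | low s]| <= m ^ K.

Let w c := #|[pred v | phi v == c]|.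
Let W c := \sum_(d | ahead a c d) w d.
Let mono (s : {ffun 'I_K -> 'I_m}) c := [forall i, phi (s i) == c].

Lemma mono_deg s c : mono s c -> deg s <= W c.
Proof.
move=> /forallP mc; rewrite /W sum_card_fibre; apply: subset_leq_card.
apply/subsetP => v; rewrite !inE; apply: Rel_ahead => i; exact/eqP/mc.
Qed.

(** At least a proportion [p ^ - K] of all tuples are monochromatic of colour [c], which exceeds the
    proportion [1 / Q] of low ones. *)
Lemma big_class_mono c : m <= p * w c -> exists2 s, mono s c & ~~ low s.
Proof.
move=> mw; apply/exists_inP; apply: contraT; rewrite negb_exists_in.
move=> /forall_inP nolow.
have cm : #|[pred s | mono s c]| = w c ^ K.
  have := card_ffun_on 'I_K [pred v | phi v == c]; rewrite card_ord => <-.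
  apply: eq_card => s; rewrite [LHS]inE; apply/forallP/ffun_onP => ms i.
    by rewrite inE; exact: ms.
  by have := ms i; rewrite inE.
have le : w c ^ K <= #|[pred s | low s]|.
  rewrite -cm; apply: subset_leq_card; apply/subsetP => s; rewrite !inE => ms.
  by have := nolow s ms; rewrite negbK.
have : m ^ K <= (p * w c) ^ K.
  by have [->|K0] := posnP K; rewrite ?expn0 // leq_exp2r.
rewrite expnMn => h; have := leq_mul (leqnn Q) le.
have : 0 < w c ^ K by rewrite expn_gt0; nia.
by nia.
Qed.

Lemma big_class_window c : m <= p * w c -> a * q * m <= b * q * W c + b * m.
Proof.
move=> /big_class_mono[s ms]; rewrite /low -leqNgt => /leq_trans; apply.
by rewrite leq_add2r leq_mul2l mono_deg ?orbT.
Qed.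

Lemma sum_classes : \sum_c w c = m.
Proof. by rewrite sum_card_fibre eq_cardT // -cardE card_ord. Qed.

Lemma all_classes_big c : m <= p * w c.
Proof.
(* Weights are multiplied by [p * q] to clear denominators: [b * m * p] then stems from the degree
   error [m / q], and [q * m] from the classes smaller than [m / p]. *)
apply: (@circle_cover_ord n a ab (p * q * m) (b * m * p) (q * m)
  (fun c => p * q * w c) (fun c => m <= p * w c)) => //.
- by rewrite -big_distrr /= sum_classes.
- move=> x /big_class_window h; rewrite -big_distrr /= -/(W x).
  by have := leq_mul (leqnn p) h; lia.
- by move=> x; rewrite -ltnNge => h; have := leq_mul (leqnn q) (ltnW h); lia.
have -> : b * (b * m * p + b * a * (q * m)) = (b ^ 2 * p + b ^ 2 * a * q) * m by lia.
rewrite ltn_pmul2r //.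
(* Each of the two error terms is at most half of [p * q]: the first by [2 * b ^ 2 <= q], the
   second, strictly, by [p = 2 * b ^ 3] and [a < b]. *)
have h1 := leq_mul (leqnn p) q_ge.
have h2 : b ^ 2 * q * a < b ^ 2 * q * b.
  rewrite ltn_pmul2l // muln_gt0 expn_gt0 /=.
  by apply: leq_trans q_ge; rewrite muln_gt0 expn_gt0.
by move: h1 h2; rewrite pE; lia.
Qed.

(** Every colour lies in [a] windows, so the windows weigh [a * m] in total; the lower bounds on the
    [n] others bound this one from above. *)
Lemma window_upper c : b * q * W c <= a * q * m + n * b * m.
Proof.
have sW : \sum_c W c = a * m.
  rewrite /W (exchange_big_dep xpredT) //= -sum_classes big_distrr /=.
  apply: eq_bigr => d _.
  rewrite sum_nat_const; congr (_ * _); rewrite -[RHS](card_aheadl ab d); exact: eq_card.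
have : \sum_(d | d != c) (a * q * m) <= \sum_(d | d != c) (b * q * W d + b * m).
  by apply: leq_sum => d _; apply/big_class_window/all_classes_big.
rewrite big_split /= !sum_nat_const -big_distrr /=.
have -> : #|[pred d : 'I_b | d != c]| = n.
  by have := cardC1 c; rewrite card_ord.
by move: sW; rewrite (bigD1 c) //=; nia.
Qed.

Let missing d (u : {ffun 'I_K -> 'I_m} * 'I_m) :=
  [&& mono u.1 d, ahead a d (phi u.2) & ~~ Rel u.1 u.2].

Lemma card_missing d : q * #|[pred u | missing d u]| <= b.+1 * m ^ K.+1.
Proof.
have -> : #|[pred u | missing d u]| = \sum_s #|[pred v | missing d (s, v)]|.
  rewrite -sum1_card big_mkcond /=.
  rewrite -(pair_bigA _ (fun s v => if missing d (s, v) then 1 else 0)) /=.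
  by apply: eq_bigr => s _; rewrite -sum1_card [RHS]big_mkcond.
rewrite big_distrr /=.
(* A low tuple may miss all [m] vertices, but such tuples are rare. For any other monochromatic
   tuple, the lower bound on its degree and the upper bound on the window differ by at most
   [b * m / q]. *)
apply: (@leq_trans (\sum_s (low s * (q * m) + b * m))).
  apply: leq_sum => s _; have [sl|snl] := boolP (low s).
    rewrite mul1n; apply: leq_trans (leq_addr _ _); rewrite leq_mul2l.
    by apply/orP; right; apply: leq_trans (max_card _) _; rewrite card_ord.
  rewrite mul0n add0n; have [ms|nm] := boolP (mono s d); last first.
    by rewrite eq_card0 ?muln0 // => v; rewrite inE /missing (negbTE nm).
  have : #|[pred v | missing d (s, v)]| + deg s <= W d.
    rewrite /W sum_card_fibre /deg -cardUI [X in _ + X]eq_card0 => [|v].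
      rewrite addn0; apply: subset_leq_card; apply/subsetP => v; rewrite !inE.
      case/orP => [/and3P[]//|]; apply: Rel_ahead => i; exact/eqP/(forallP ms).
    by rewrite !inE /missing /=; case: (Rel s v); rewrite ?andbF.
  have := window_upper d; move: snl; rewrite /low -leqNgt.
  move: (#|_|) (W d) (deg s) => x y z h1 h2 h3.
  rewrite -(leq_pmul2l (ltn0Sn n)).
  by have := leq_mul (leqnn (b * q)) h3; nia.
rewrite big_split /= -big_distrl /= sum_nat_const card_ffun !card_ord.
have -> : (\sum_s low s) = #|[pred s | low s]|.
  rewrite -sum1_card [RHS]big_mkcond; apply: eq_bigr => s _.
  by rewrite inE; case: (low s).
have := leq_mul Q_ge (leqnn #|[pred s | low s]|).
move: low_rare; rewrite expnS => h1 h2.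
have := leq_mul (leq_trans h2 h1) (leqnn m); by lia.
Qed.

(** Union bound over the configurations [(d, x, (e, j))]: each is missing with probability at most
    [b.+1 / q], and by [q_gt] these probabilities add up to less than that of respecting the
    colours. *)
Lemma coloured_gadget : exists h : {ffun 'I_b * 'I_t -> 'I_m},
  forall d (x : {ffun 'I_K -> 'I_t}) e j, injective x -> ahead a d e ->
    Rel [ffun i => h (d, x i)] (h (e, j)).
Proof.
pose col (h : {ffun 'I_b * 'I_t -> 'I_m}) := [forall i, phi (h i) == i.1].
pose N := #|{ffun 'I_b * 'I_t -> 'I_m}|.
have N0 : 0 < N by rewrite /N card_ffun expn_gt0 card_ord m0.
have Ncol : N <= p ^ (b * t) * #|[pred h | col h]|.
  have -> : #|[pred h | col h]| = \prod_(i : 'I_b * 'I_t) w i.1.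
    rewrite -(eq_card (A := family (fun i : 'I_b * 'I_t => [pred v | phi v == i.1]))).
      by rewrite card_family foldrE big_map big_enum.
    by move=> h; rewrite !inE.
  have -> : b * t = #|{: 'I_b * 'I_t}| by rewrite card_prod !card_ord.
  rewrite -prod_nat_const -big_split /N card_ffun card_ord -prod_nat_const /=.
  by apply: leq_prod => i _; exact: all_classes_big.
pose valid (z : con) := injectiveb z.1.2 && ahead a z.1.1 z.2.1.
pose get (z : con) (h : {ffun 'I_b * 'I_t -> 'I_m}) :=
  (reindex_ffun h (fun i => (z.1.1, z.1.2 i)), h z.2).
have cz z : valid z -> q * #|[pred h | missing z.1.1 (get z h)]| <= b.+1 * N.
  case: z => [[d x] [e j]] /andP[/= /injectiveP xI de].
  have := @card_resample_tuple _ _ 'I_m (fun i => (d, x i)) (e, j) [pred u | missing d u].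
  have i1 : injective (fun i => (d, x i)) by move=> i i' [/xI].
  have i2 i : (d, x i) != (e, j) by apply: contraTneq de => -[-> _]; rewrite aheadxx.
  move/(_ i1 i2); rewrite !card_ord -/N => h.
  have hm := leq_mul (card_missing d) (leqnn N).
  rewrite -(leq_pmul2r (_ : 0 < m ^ K.+1)) ?expn_gt0 ?m0 //.
  have {}h : #|[pred h | missing d (get (d, x, (e, j)) h)]| * (m ^ K * m) =
    #|[pred u | missing d u]| * N by exact: h.
  rewrite -[_ <= _]/(q * #|[pred h | missing d (get (d, x, (e, j)) h)]| * m ^ K.+1 <= _).
  rewrite expnSr -[X in X <= _]mulnA h.
  by move: hm; rewrite -expnSr; lia.
case: (boolP [exists h, col h && [forall z, valid z ==> ~~ missing z.1.1 (get z h)]]).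
  case/existsP => h /andP[/forallP ch /forallP hz]; exists h => d x e j xI de.
  have := hz (d, x, (e, j)); rewrite /valid /missing /= de andbT.
  have -> : injectiveb x by apply/injectiveP.
  rewrite (eqP (ch _)) de /=; have -> : mono (reindex_ffun h (fun i => (d, x i))) d.
    by apply/forallP => i; rewrite ffunE (eqP (ch _)).
  by rewrite negbK.
rewrite negb_exists => /forallP no; exfalso.
have : #|[pred h | col h]| <= \sum_(z | valid z) #|[pred h | missing z.1.1 (get z h)]|.
  rewrite -sum1_card; under [X in _ <= X]eq_bigr do rewrite -sum1_card big_mkcond.
  rewrite exchange_big /= big_mkcond leq_sum // => h _; case: ifP => // ch.
  have := no h; rewrite inE in ch; rewrite ch /= negb_forall => /existsP[z].
  rewrite negb_imply negbK => /andP[vz mz].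
  by rewrite (bigD1 z) //= inE mz.
move=> h; have := leq_mul (leqnn q) h; rewrite big_distrr /=.
move/leq_trans/(_ (leq_sum _ cz)); rewrite sum_nat_const.
move/leq_trans/(_ (leq_mul (max_card _) (leqnn _))).
rewrite !card_prod card_ffun !card_ord => h2.
have h3 := leq_mul (leqnn q) Ncol.
have h6 := leq_mul (leqnn (p ^ (b * t))) h2.
have h7 : p ^ (b * t) * (b * t ^ K * (b * t)) * b.+1 * N < q * N by rewrite ltn_pmul2r.
by move: h3 h6 h7; lia.
Qed.
End ColouredGadget.

(** * The upper bound on the codegree *)

Lemma min_codegree_le k (V : finType) (H : kgraph k V) (S : {set V}) :
  #|S| = k.-1 -> min_codegree H <= codegree H S.
Proof.
move=> Sk; rewrite /min_codegree; have := mem_index_enum S.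
elim: (index_enum _) => // S' r IH; rewrite inE big_cons => /orP[/eqP <-|/IH le].
  by rewrite Sk eqxx geq_minl.
by case: ifP => // _; apply: leq_trans (geq_minr _ _) le.
Qed.

Lemma le_min_codegree k (V : finType) (H : kgraph k V) l :
    l <= #|V| -> (forall S : {set V}, #|S| = k.-1 -> l <= codegree H S) ->
  l <= min_codegree H.
Proof.
move=> lV lS; rewrite /min_codegree.
apply: (big_ind (fun x => l <= x)) => // [x y lx ly|S /eqP/lS //].
by rewrite leq_min lx.
Qed.

Section Upper.
Variables (n a K : nat) (V : finType) (H : kgraph K.+1 V).

Definition link (u : {ffun 'I_K -> V}) (v : V) :=
  v |: [set u i | i : 'I_K] \in edges H.

Lemma link_card u v : link u v -> #|[set u i | i : 'I_K]| = K /\ forall i, u i != v.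
Proof.
move=> /(forall_inP (edges_uniform H)); rewrite cardsU1 => /eqP.
have : #|[set u i | i : 'I_K]| <= K by rewrite -[leqRHS]card_ord leq_imset_card.
case: (boolP (v \in _)) => [_|nv] /= le cE; first by lia.
split; first by lia.
by move=> i; apply: contraNneq nv => <-; exact: imset_f.
Qed.

Lemma link_ahead (chi : V -> 'I_n.+1) (u : {ffun 'I_K -> V}) v c :
    good a chi (v |: [set u i | i : 'I_K]) -> (forall i, chi (u i) = c) ->
  ahead (n := n) a c (chi v).
Proof.
move=> /goodP g uc; apply: g => [|w]; first by rewrite setU11.
by rewrite !inE => /orP[->//|/imsetP[i _ ->] _].
Qed.

Lemma card_link (u : {ffun 'I_K -> V}) : #|[set u i | i : 'I_K]| = K ->
  min_codegree H <= #|[pred v | link u v]|.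
Proof. by move=> uK; rewrite -(codegreeE _ uK); exact: min_codegree_le. Qed.

(* The colouring of the gadget may depend on the additional vertex [v], but the
   tuples [S c] do not. *)
Lemma gadget_bound N t (T : 'I_n.+1 -> 'I_t -> V) :
    coprime a n.+1 -> 0 < a -> a < n.+1 -> 0 < K -> n.+1 * K <= t ->
    family_free (obstructions n a K.+1 N) H -> n.+1 * t + 1 < N ->
    (forall d (x : {ffun 'I_K -> 'I_t}) e j, injective x -> ahead a d e ->
       link [ffun i => T d (x i)] (T e j)) ->
  n.+1 * min_codegree H <= a * #|V|.
Proof.
move=> co a0 ab K0 tK Hfree tN HT.
have Kt : K <= t by nia.
pose x0 : {ffun 'I_K -> 'I_t} := [ffun i => widen_ord Kt i].
have x0I : injective x0 by move=> i j; rewrite !ffunE => /(congr1 val) /= /val_inj.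
pose S c : {ffun 'I_K -> V} := [ffun i => T c (x0 i)].
have SK c : #|[set S c i | i : 'I_K]| = K.
  have [e ce] : exists e, ahead a c e.
    have : 0 < #|[pred d | ahead a c d]| by rewrite card_ahead.
    by case/card_gt0P => e; rewrite inE; exists e.
  by have [] := link_card (HT c x0 e (x0 (Ordinal K0)) x0I ce).
have few v : #|[pred c | link (S c) v]| <= a.
  pose TT := [set T z.1 z.2 | z : 'I_n.+1 * 'I_t]; pose U := v |: TT.
  have UN : #|U| < N.
    apply: leq_ltn_trans tN; rewrite cardsU1 addnC leq_add ?leq_b1 //.
    by apply: leq_trans (leq_imset_card _ _) _; rewrite card_prod !card_ord.
  have [chi chiP] := local_colouring Hfree UN.
  have TU c j : T c j \in U.
    by rewrite !inE; apply/orP; right; apply/imsetP; exists (c, j).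
  have lU c (x : {ffun 'I_K -> 'I_t}) w : w \in U -> link [ffun i => T c (x i)] w ->
      good a chi (w |: [set [ffun i => T c (x i)] i | i : 'I_K]).
    move=> wU lw; apply: chiP lw _; apply/subsetP => w'; rewrite !inE.
    case/orP => [/eqP ->|/imsetP[i _ ->]]; first by move: wU; rewrite !inE.
    by rewrite ffunE; have := TU c (x i); rewrite !inE.
  have [p pI pE] : exists2 p : 'I_n.+1 -> 'I_n.+1, injective p &
      forall c j, chi (T c j) = p c.
    apply: (rigid_colouring ab co a0 K0 tK) => d c x xI xc e j de.
    apply: link_ahead (lU _ _ _ (TU e j) (HT d x e j xI de)) _ => i.
    by rewrite ffunE xc.
  (* If [S c] and [v] form an edge, then [chi v] is ahead of [p c]; as [p] is injective, this
     happens for at most [a] parts. *)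
  apply: (@leq_trans #|[pred c | ahead a (p c) (chi v)]|).
    apply: subset_leq_card; apply/subsetP => c; rewrite !inE => lc.
    by apply: link_ahead (lU c x0 v (setU11 _ _) lc) _ => i; rewrite ffunE.
  rewrite -{2}(card_aheadl ab (chi v)) -(card_image pI).
  by apply: subset_leq_card; apply/subsetP => _ /imageP[c ca ->]; move: ca; rewrite !inE.
(* Double counting of the pairs [(c, v)] such that [S c] and [v] form an edge. *)
apply: (@leq_trans (\sum_c #|[pred v | link (S c) v]|)).
  rewrite -[X in X * _](card_ord n.+1) -sum_nat_const.
  by apply: leq_sum => c _; exact: card_link.
have -> : \sum_c #|[pred v | link (S c) v]| = \sum_v #|[pred c | link (S c) v]|.
  under eq_bigr do rewrite -sum1_card big_mkcond.
  rewrite exchange_big /=; apply: eq_bigr => v _.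
  by rewrite -sum1_card [RHS]big_mkcond.
by rewrite mulnC -sum_nat_const; apply: leq_sum => v _; exact: few.
Qed.
End Upper.

Lemma codegree_upper (n a K : nat) :
    coprime a n.+1 -> a < n.+1 -> 0 < K ->
  exists N n0, forall (V : finType) (H : kgraph K.+1 V), n0 <= #|V| ->
    family_free (obstructions n a K.+1 N) H -> n.+1 * min_codegree H <= a * #|V|.
Proof.
move=> co ab K0; have [a0|a0] := posnP a.
  have n0 : n = 0 by move: co; rewrite a0 /coprime gcd0n; lia.
  (* With a single colour and an empty window no edge is good, so a single edge, on [K.+1] vertices,
     is already forbidden. The bound [K <= #|V|] provides a [K]-set to evaluate the codegree at. *)
  exists K.+2, K => V H KV Hfree; rewrite {}n0 {}a0 in Hfree *.
  have noedge e : e \notin edges H.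
    apply/negP => eH; have /eqP eK := forall_inP (edges_uniform H) e eH.
    have [|chi /(_ e eH (subxx _))/goodP g] := local_colouring (U := e) Hfree.
      by rewrite eK.
    have [v ve] : exists v, v \in e by apply/card_gt0P; rewrite eK.
    have : ahead 0 (chi v) (chi v) by apply: g => // u _ _; rewrite !ord1.
    by rewrite aheadxx.
  have [S SK] : exists S : {set V}, #|S| = K.
    have /card_gt0P[S] : 0 < #|[set S : {set V} | #|S| == K]|.
      by rewrite card_draws bin_gt0.
    by rewrite inE => /eqP; exists S.
  rewrite mul1n mul0n; apply: (leq_trans (@min_codegree_le K.+1 _ H S SK)).
  by rewrite codegreeE // eq_card0 // => v; rewrite inE (negbTE (noedge _)).
(* [t] allows the pigeonhole argument on each part, [q] and [Q] meet the conditions for a coloured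
   gadget, and [m] those for sampling. *)
pose b := n.+1; pose t := b * K; pose p := 2 * b ^ 3.
pose q := (2 * b ^ 2 + p ^ (b * t) * (b * t ^ K * (b * t)) * b.+1).+1.
pose Q := (q + p ^ K).+1.
pose m := (2 * q * K + Q * (2 * K ^ 2 + 4 * q ^ 2)).+1.
(* The order of the obstructions must exceed both the sample size [m] and [b * t + 1], the size of
   the gadget with one more vertex. *)
exists (m + b * t).+2, m => V H mV Hfree; rewrite leqNgt; apply/negP => dV.
have Ed (u : {ffun 'I_K -> V}) : injective u -> a * #|V| <= b * #|[pred v | link H u v]|.
  move=> uI; apply: leq_trans (ltnW dV) _; rewrite leq_mul2l card_link ?orbT //.
  by rewrite card_imset // card_ord.
have Eu (u : {ffun 'I_K -> V}) i : ~~ link H u (u i).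
  by apply/negP => /link_card[_ /(_ i)]; rewrite eqxx.
have h1 : 0 < a <= b by rewrite a0 ltnW.
have h2 : 0 < m <= #|V| by [].
have h3 : 2 * q * K <= m by rewrite /m; apply/leqW/leq_addr.
have h4 : Q * (2 * K ^ 2 + 4 * q ^ 2) <= m by rewrite /m; apply/leqW/leq_addl.
have [g gP] := sampling h1 (ltn0Sn _ : 0 < q) h2 h3 h4 Ed Eu.
pose U := [set g i | i : 'I_m].
have [|chi chiP] := local_colouring (U := U) Hfree.
  apply: (@leq_ltn_trans m); last by rewrite !ltnS; apply/leqW/leq_addr.
  by apply: leq_trans (leq_imset_card _ _) _; rewrite card_ord.
pose Rel (s : {ffun 'I_K -> 'I_m}) v := link H (reindex_ffun g s) (g v).
have RelP (s : {ffun 'I_K -> 'I_m}) c v :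
    (forall i, chi (g (s i)) = c) -> Rel s v -> ahead a c (chi (g v)).
  move=> sc lsv; apply: (link_ahead (u := reindex_ffun g s)); last first.
    by move=> i; rewrite ffunE.
  apply: chiP lsv _; apply/subsetP => w; rewrite !inE.
  case/orP => [/eqP ->|/imsetP[i _ ->]]; first exact: imset_f.
  by rewrite ffunE; exact: imset_f.
have q1 : 2 * b ^ 2 <= q by rewrite /q; apply/leqW/leq_addr.
have q2 : p ^ (b * t) * (b * t ^ K * (b * t)) * b.+1 < q by rewrite /q ltnS leq_addl.
have Q1 : q <= Q by apply/leqW/leq_addr.
have Q2 : p ^ K < Q by rewrite /Q ltnS leq_addl.
have [h hP] := coloured_gadget co a0 ab (erefl p) q1 q2 Q1 Q2 (ltn0Sn _ : 0 < m) RelP gP.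
move: dV; rewrite ltnNge => /negP; apply.
apply: (gadget_bound (T := fun c j => g (h (c, j))) co a0 ab K0 (leqnn t) Hfree).
  by rewrite -/b; lia.
move=> d x e j xI de; have := hP d x e j xI de; rewrite /Rel.
by congr (link _ _ _); apply/ffunP => i; rewrite !ffunE.
Qed.

(** * The extremal construction *)

(** If [S] has a single colour [c], the new vertex takes a colour ahead of [c]. If all of [S] but
    [u] has one colour, the new colour is one that [chi u] is ahead of. Otherwise every extension is
    good and any [a] colours will do. *)
Lemma good_window (n a : nat) (V : finType) (chi : V -> 'I_n.+1) (S : {set V}) :
    a < n.+1 -> 1 < #|S| ->
  exists2 P : pred 'I_n.+1, #|P| = a &
    forall v, v \notin S -> P (chi v) -> good a chi (v |: S).
Proof.
move=> an S1.
have other w : exists2 u, u \in S & u != w.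
  have : 0 < #|S :\ w| by have := cardsD1 w S; case: (w \in S) => /=; lia.
  by case/card_gt0P => u; rewrite !inE => /andP[uw uS]; exists u.
have [[c Sc]|nmono] := boolp.pselect (exists c, forall u, u \in S -> chi u = c).
  exists [pred d | ahead a c d] => [|v vS /= cv]; first exact: card_ahead.
  apply/goodP => w c'; rewrite !inE => /orP[/eqP ->|wS] wc.
    have [u uS uv] := other v; suff <- : c = c' by [].
    by rewrite -(wc u) ?inE ?uS ?orbT // Sc.
  have [u uS uw] := other w.
  have cE : c = c' by rewrite -(wc u) ?inE ?uS ?orbT // Sc.
  have vw : v != w by apply: contraNneq vS => ->.
  by move: cv; rewrite (wc v) ?inE ?eqxx // cE aheadxx.
have [[u uS [c uc]]|nnear] := boolp.pselect (exists2 u, u \in S &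
    exists c, forall w, w \in S -> w != u -> chi w = c).
  exists [pred d | ahead a d (chi u)] => [|v vS /= cv]; first exact: card_aheadl.
  apply/goodP => w c'; rewrite !inE => /orP[/eqP ->|wS] wc.
    exfalso; apply: nmono; exists c' => x xS; apply: wc; rewrite ?inE ?xS ?orbT //.
    by apply: contraNneq vS => <-.
  have vw : v != w by apply: contraNneq vS => ->.
  have cv' : chi v = c' by apply: wc; rewrite ?inE ?eqxx.
  have [->|wu] := eqVneq w u; first by rewrite -cv'.
  have uc' : chi u = c' by apply: wc; rewrite ?inE ?uS ?orbT // eq_sym.
  by move: cv; rewrite cv' uc' aheadxx.
exists [pred d | ahead a ord0 d] => [|v vS /= cv]; first exact: card_ahead.
apply/goodP => w c'; rewrite !inE => /orP[/eqP ->|wS] wc; exfalso.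
  apply: nmono; exists c' => x xS; apply: wc; rewrite ?inE ?xS ?orbT //.
  by apply: contraNneq vS => <-.
apply: nnear; exists w => //; exists c' => x xS xw.
by apply: wc; rewrite ?inE ?xS ?orbT.
Qed.

Lemma card_residue_class n N (c : 'I_n.+1) :
  N %/ n.+1 <= #|[pred v : 'I_N | inZp v == c]|.
Proof.
have lt (i : 'I_(N %/ n.+1)) : i * n.+1 + c < N.
  have := ltn_ord i; have := ltn_ord c; have := leq_trunc_div N n.+1; nia.
rewrite -[leqLHS]card_ord.
have fI : injective (fun i => Ordinal (lt i)).
  by move=> i j /(congr1 val) /= h; apply/val_inj => /=; nia.
rewrite -(card_image fI); apply: subset_leq_card; apply/subsetP => _ /imageP[i _ ->].
by rewrite inE -val_eqE /= modnMDl modn_small.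
Qed.

(** Vertices are coloured by their residues. Up to the factor [n.+1], the loss [a] comes from
    rounding down the [a] class sizes and [K] from the vertices of [S] itself. *)
Lemma co_ex_lower (n a K N M : nat) : a < n.+1 -> 1 < K ->
  a * M <= n.+1 * co_ex M (obstructions n a K.+1 N) + n.+1 * (a + K).
Proof.
move=> an K1; pose chi (i : 'I_M) : 'I_n.+1 := inZp i.
pose E := [set e : {set 'I_M} | (#|e| == K.+1) && good a chi e].
have Eu : [forall e in E, #|e| == K.+1] by apply/forall_inP => e; rewrite inE => /andP[].
pose H := KGraph Eu.
have Hfree : family_free (obstructions n a K.+1 N) H.
  apply: colourable_free; apply/existsP; exists [ffun i => chi i].
  apply/forall_inP => e; rewrite inE => /andP[_ /goodP g].
  apply/goodP => v c ve uc; rewrite ffunE; apply: g => // u ue uv.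
  by rewrite -(uc u) // ffunE.
have div_le : a * (M %/ n.+1) <= M by have := leq_trunc_div M n.+1; nia.
have low : a * (M %/ n.+1) - K <= min_codegree H.
  (* The minimum starts from the default [#|V|], so the bound must not exceed [M] either. *)
  apply: le_min_codegree; first by rewrite card_ord; lia.
  move=> S /= SK.
  have S2 : 1 < #|S| by rewrite SK.
  have [P Pa PS] := good_window chi an S2.
  rewrite codegreeE // leq_subLR -{1}SK.
  apply: (@leq_trans #|[pred v | P (chi v)]|).
    rewrite -sum_card_fibre -Pa -sum_nat_const.
    by apply: leq_sum => c _; exact: card_residue_class.
  rewrite -cardUI; apply: leq_trans (leq_addr _ _).
  apply: subset_leq_card; apply/subsetP => v; rewrite !inE => Pv.
  case: (boolP (v \in S)) => //= vS.
  by rewrite cardsU1 vS SK eqxx PS.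
have le : min_codegree H <= co_ex M (obstructions n a K.+1 N).
  exact: bigop.bigmax_sup Hfree (leqnn _).
have h1 := ltn_ceil M (ltn0Sn n).
have h2 : a * (M %/ n.+1) <= co_ex M (obstructions n a K.+1 N) + K.
  by rewrite addnC -leq_subLR; exact: leq_trans low le.
have h3 := leq_mul (leqnn a) (ltnW h1).
have h4 := leq_mul (leqnn n.+1) h2.
by move: h3 h4; rewrite mulSn; lia.
Qed.

(* Passage to the limit *)
From mathcomp Require Import all_classical all_reals all_analysis.
Import numFieldNormedType.Exports.
Local Open Scope ring_scope.
Local Open Scope classical_set_scope.

Lemma cvg_ratio (R : realType) (u : nat -> nat) (a b C n0 : nat) : (0 < b)%N ->
    (forall n, n0 <= n -> b * u n <= a * n)%N ->
    (forall n, a * n <= b * u n + C)%N ->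
  (fun n => (u n)%:R / n%:R : R) @ \oo --> (a%:R / b%:R : R).
Proof.
move=> b0 up lo.
have bR : (0 : R) < b%:R by rewrite ltr0n.
have hC : (fun n : nat =>
    a%:R / b%:R - C%:R / b%:R * n.+1%:R^-1 : R) @ \oo --> (a%:R / b%:R : R).
  rewrite -[X in _ --> X]subr0 -(mulr0 (C%:R / b%:R)).
  by apply: cvgB; [exact: cvg_cst | apply: cvgM; [exact: cvg_cst | exact: cvg_harmonic]].
(* The shift by one makes the denominator positive and matches the harmonic sequence in [hC]. *)
rewrite -cvg_shiftS.
apply: (squeeze_cvgr _ hC (cvg_cst _)).
exists n0 => // n /= n0n; have nR : (0 : R) < n.+1%:R by rewrite ltr0n.
have h1 : (b * u n.+1)%:R <= (a * n.+1)%:R :> R by rewrite ler_nat up // ltnW.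
have h2 : (a * n.+1)%:R <= (b * u n.+1 + C)%:R :> R by rewrite ler_nat lo.
rewrite natrD !natrM in h1 h2.
apply/andP; split.
  have -> : a%:R / b%:R - C%:R / b%:R * n.+1%:R^-1 =
      (a%:R * n.+1%:R - C%:R) / (b%:R * n.+1%:R) :> R.
    by field; rewrite !lt0r_neq0.
  have -> : (u n.+1)%:R / n.+1%:R = b%:R * (u n.+1)%:R / (b%:R * n.+1%:R) :> R.
    by field; rewrite !lt0r_neq0.
  by rewrite ler_pM2r ?invr_gt0 ?mulr_gt0 // lerBlDr.
by rewrite ler_pdivrMr // mulrAC ler_pdivlMr // mulrC.
Qed.

Theorem theorem1p1 (R : realType) (k : nat) (hk : (3 <= k)%N)
    (alpha : rat) (halpha0 : 0 <= alpha) (halpha1 : alpha < 1) :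
  exists Fs : finite_family k,
    cvgn (co_ex_ratio R Fs) /\ codegree_turan_density R Fs = ratr alpha.
Proof.
case: k hk => // K K2; rewrite ltnS in K2.
pose a := `|numq alpha|%N; pose n := `|denq alpha|.-1%N.
have nE : n.+1 = `|denq alpha|%N by rewrite prednK // absz_gt0 denq_neq0.
have aE : (a : int) = numq alpha by rewrite gez0_abs // numq_ge0.
have bE : (n.+1 : int) = denq alpha by rewrite nE gez0_abs // denq_ge0.
have alphaE : ratr alpha = a%:R / n.+1%:R :> R.
  by rewrite /ratr -aE -bE.
have co : coprime a n.+1 by rewrite nE coprime_num_den.
have ab : (a < n.+1)%N.
  rewrite -ltz_nat aE bE; move: halpha1; rewrite -{1}[alpha]divq_num_den.
  by rewrite ltr_pdivrMr ?ltr0z ?denq_gt0 // mul1r ltr_int.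
have [N [n0 upper]] := codegree_upper co ab (ltnW K2).
exists (obstructions n a K.+1 N).
suff cv : co_ex_ratio R (obstructions n a K.+1 N) @ \oo --> (ratr alpha : R).
  split; first by apply/cvg_ex; exists (ratr alpha).
  exact: cvg_lim cv.
rewrite alphaE; apply: (@cvg_ratio R _ a n.+1 (n.+1 * (a + K)) n0) => // m; last first.
  exact: co_ex_lower.
move=> n0m.
(* The factor [n.+1] is moved across as a floor division so that the maximum can be bounded term by
   term. *)
have : (co_ex m (obstructions n a K.+1 N) <= a * m %/ n.+1)%N.
  apply/bigmax_leqP => H Hfree; rewrite leq_divRL // mulnC.
  by have := upper _ H; rewrite card_ord; apply.
by rewrite leq_divRL // mulnC.
Qed.
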